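(* Let $d \ge 1$ and let $g : \mathbb{R}^d \to \mathbb{R}^d$ be continuous and linearly homogeneous. Suppose there exists $r > 0$ such that $g^n(\mathbf{x}) \to \mathbf{0}$ as $n \to \infty$ for all $\mathbf{x} \in B_r$. Then (i) $\mathbf{0}$ is a globally asymptotically stable fixed point of $g$, and (ii) $g^n(B_r) \to \mathbf{0}$ uniformly, i.e. the sequence of functions $\{g^n\}$ converges to $\mathbf{0}$ uniformly on $B_r$.
   Context: $\mathbf{0}$ is the origin of $\mathbb{R}^d$, $\|\cdot\|$ is the Euclidean norm, $B_r = \{\mathbf{x} \in \mathbb{R}^d : \|\mathbf{x}\| < r\}$, and $g^n$ denotes the $n$-fold composition of $g$ with itself. A map $g : \mathbb{R}^d \to \mathbb{R}^d$ is linearly homogeneous if $g(\alpha \mathbf{x}) = \alpha g(\mathbf{x})$ for all $\mathbf{x} \in \mathbb{R}^d$ and all real $\alpha \ge 0$. (In particular $g(\mathbf{0}) = \mathbf{0}$.) Let $F : \mathbb{R}^d \to \mathbb{R}^d$ be continuous with $F(\mathbf{0}) = \mathbf{0}$. The fixed point $\mathbf{0}$ is Lyapunov stable if for all $\varepsilon > 0$ there exists $\delta > 0$ such that $F^n(\mathbf{x}) \in B_\varepsilon$ for all $\mathbf{x} \in B_\delta$ and all $n \ge 0$. It is globally asymptotically stable if it is Lyapunov stable and $F^n(\mathbf{x}) \to \mathbf{0}$ as $n \to \infty$ for all $\mathbf{x} \in \mathbb{R}^d$. *)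

(* Defs.v *)
From mathcomp Require Import all_boot all_order all_algebra.
From mathcomp Require Import all_classical all_reals all_analysis.

Set Implicit Arguments.
Unset Strict Implicit.
Unset Printing Implicit Defensive.

Import Order.TTheory GRing.Theory Num.Theory.
Import numFieldNormedType.Exports.

Local Open Scope classical_set_scope.
Local Open Scope ring_scope.

(* R^d is 'rV[R]_d.  The norm `|x| of that type is the sup norm, so the
   Euclidean norm and its balls are defined here.  The two norms induce the same
   topology and the same uniform structure on 'rV[R]_d, so limits, continuity
   and uniform convergence in 'rV[R]_d are the Euclidean ones. *)

Definition enorm (R : realType) (d : nat) (x : 'rV[R]_d) : R :=
  Num.sqrt (\sum_(i < d) x ord0 i ^+ 2).

Definition eball (R : realType) (d : nat) (r : R) : set 'rV[R]_d :=
  [set x | enorm x < r].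

Arguments eball {R} d r.

Definition linearly_homogeneous (R : realType) (d : nat)
    (g : 'rV[R]_d -> 'rV[R]_d) : Prop :=
  forall (x : 'rV[R]_d) (a : R), 0 <= a -> g (a *: x) = a *: g x.

Definition lyapunov_stable (R : realType) (d : nat)
    (F : 'rV[R]_d -> 'rV[R]_d) : Prop :=
  forall eps : R, 0 < eps -> exists2 delta : R, 0 < delta &
    forall x, eball d delta x -> forall n : nat, eball d eps (iter n F x).

(* The origin is only called stable when it is a fixed point, hence F 0 = 0. *)
Definition globally_asymptotically_stable (R : realType) (d : nat)
    (F : 'rV[R]_d -> 'rV[R]_d) : Prop :=
  [/\ F 0 = 0,
      lyapunov_stable F &
      forall x : 'rV[R]_d, iter n F x @[n --> \oo] --> (0 : 'rV[R]_d)].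

(* Main.v *)
Require Import Defs.
From mathcomp Require Import all_boot all_order all_algebra.
From mathcomp Require Import all_classical all_reals all_analysis.
Import Order.TTheory GRing.Theory Num.Theory.
Import numFieldNormedType.Exports.
Local Open Scope classical_set_scope.
Local Open Scope ring_scope.

(** Homogeneity lets every estimate on the unit ball be rescaled to an estimate
    that is proportional to the norm of the point.  Every orbit tends to 0
    ([homogeneous_local_to_global]), so
    each point of the closed unit ball has a positive iterate of norm below
    1/2; by continuity the same iterate works on a neighbourhood, and by
    compactness one bound N on its index serves the whole ball
    ([uniform_halving_time]).  Rescaled, every orbit halves its norm again and
    again, each time within N further steps.  Between two halvings at most N
    steps are made, and these can enlarge the norm by a bounded factor M only,
    since a continuous homogeneous map is bounded ([homogeneous_bounded]).
    Hence g^n is at most M / 2^k times the norm once n >= k N ([halving_decay]).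
    Taking k = 0 gives Lyapunov stability, and letting k grow gives convergence
    that is uniform on bounded sets.

    Compactness and the estimates use the sup norm `|x|, whose topology is the
    one of the row vectors; the Euclidean balls are compared with its balls
    through [norm_le_enorm] and [enorm_le_norm]. *)

Lemma norm_le_enorm (R : realType) (d : nat) (x : 'rV[R]_d) :
  `|x| <= enorm x.
Proof.
rewrite /Num.Def.normr /= mx_normrE; apply: bigmax_le => [|[i j] _ /=].
  exact: sqrtr_ge0.
rewrite ord1 -sqrtr_sqr ler_wsqrtr // (bigD1 j) //= lerDl.
by apply: sumr_ge0 => k _; exact: sqr_ge0.
Qed.

Lemma enorm_le_norm (R : realType) (d : nat) (x : 'rV[R]_d) :
  enorm x <= Num.sqrt d%:R * `|x|.
Proof.
rewrite -[X in _ * X](ger0_norm (normr_ge0 x)) -sqrtr_sqr -sqrtrM ?ler0n //.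
apply: ler_wsqrtr; rewrite mulr_natl -[X in _ *+ X](card_ord d) -sumr_const.
apply: ler_sum => i _; rewrite -(real_normK (num_real _)).
rewrite lerXn2r ?nnegrE ?normr_ge0 //.
rewrite [leRHS]/Num.Def.normr /= mx_normrE.
exact: (le_bigmax _ (fun ij => `|x ij.1 ij.2|) (ord0, i)).
Qed.

Lemma homogeneous_iter (R : realType) (d : nat) (g : 'rV[R]_d -> 'rV[R]_d) n :
  linearly_homogeneous g -> linearly_homogeneous (iter n g).
Proof. by move=> gh x a a0; elim: n => //= n ->; rewrite gh. Qed.

Lemma continuous_iter (T : topologicalType) (g : T -> T) n :
  continuous g -> continuous (iter n g).
Proof.
move=> gc; elim: n => [|n IH] x; first exact: cvg_id.
exact: (continuous_comp (IH x) (gc _)).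
Qed.

Lemma homogeneous0 (R : realType) (d : nat) (g : 'rV[R]_d -> 'rV[R]_d) :
  linearly_homogeneous g -> g 0 = 0.
Proof. by move=> gh; have := gh 0 0 (lexx _); rewrite !scale0r. Qed.

(** As for linear maps: continuity at 0 bounds h on a small ball, and
    rescaling spreads the bound to the whole space. *)
Lemma homogeneous_bounded (R : realType) (d : nat) (h : 'rV[R]_d -> 'rV[R]_d) :
  continuous h -> linearly_homogeneous h ->
  exists2 M : R, 0 <= M & forall x, `|h x| <= M * `|x|.
Proof.
move=> hc hh; have /cvgrPdist_lt/(_ 1 ltr01) := hc 0.
rewrite homogeneous0 // => /nbhs_ballP[e /= e0 he].
exists (2 / e) => [|x]; first by rewrite divr_ge0 // ltW.
have [->|x0] := eqVneq x 0; first by rewrite homogeneous0 // normr0 mulr0.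
have nx : 0 < `|x| by rewrite normr_gt0.
have a0 : 0 < e / 2 / `|x| by rewrite !divr_gt0.
have /he : ball 0 e (e / 2 / `|x| *: x).
  rewrite -ball_normE /= sub0r normrN normrZ gtr0_norm // divfK ?gt_eqF //.
  by rewrite ltr_pdivrMr // ltr_pMr // ltr1n.
rewrite /= sub0r normrN (hh _ _ (ltW a0)) normrZ gtr0_norm // mulrC -ltr_pdivlMr //.
by move=> /ltW; rewrite div1r !invf_div mulrA [`|x| * 2]mulrC mulrAC.
Qed.

Lemma homogeneous_iter_bounded (R : realType) (d : nat)
    (g : 'rV[R]_d -> 'rV[R]_d) (N : nat) :
  continuous g -> linearly_homogeneous g ->
  exists2 M : R, 0 <= M &
    forall n x, (n <= N)%N -> `|iter n g x| <= M * `|x|.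
Proof.
move=> gc gh; elim: N => [|N [M M0 IH]].
  by exists 1 => // n x; rewrite leqn0 => /eqP ->; rewrite mul1r.
have [M' M'0 bM'] := @homogeneous_bounded R d _
  (continuous_iter _ _ N.+1 gc) (homogeneous_iter _ _ _ N.+1 gh).
exists (M + M') => [|n x]; first exact: addr_ge0.
rewrite leq_eqVlt mulrDl => /predU1P[->|].
  by apply: le_trans (bM' x) _; rewrite lerDr mulr_ge0.
by move=> nN; apply: le_trans (IH n x nN) _; rewrite lerDl mulr_ge0.
Qed.

(** The index j is required to be positive so that passing from x to its j-th
    iterate makes progress along the orbit. *)
Lemma uniform_halving_time (R : realType) (d : nat)
    (g : 'rV[R]_d -> 'rV[R]_d) :
  continuous g -> linearly_homogeneous g ->
  (forall x, iter n g x @[n --> \oo] --> (0 : 'rV[R]_d)) ->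
  exists N : nat, forall x, exists2 j : nat,
    (0 < j <= N)%N & `|iter j g x| <= `|x| / 2.
Proof.
move=> gc gh gcv.
pose K := [set x : 'rV[R]_d | `|x| <= 1].
have cK : compact K.
  apply: bounded_closed_compact.
    by exists 1; split => // M M1 x /= /le_trans; apply; exact: ltW.
  apply: (@preimage_closed _ _ (fun x : 'rV[R]_d => `|x|) [set y | y <= 1]).
    by move=> x _; exact: norm_continuous.
  exact: closed_le.
pose P N (x : 'rV[R]_d) :=
  exists2 j : nat, (0 < j <= N)%N & `|iter j g x| < 2^-1.
have : \forall N \near \oo, K `<=` P N.
  move/compact_near_coveringP : cK; apply => x _.
  have half0 : 0 < 2^-1 :> R by rewrite invr_gt0.
  have /cvgrPdist_lt/(_ _ half0)[m _ xm] := gcv x.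
  have gxm : `|iter m.+1 g x| < 2^-1.
    by have := xm m.+1 (leqnSn m); rewrite /= sub0r normrN.
  have gnm : \forall y \near x, `|iter m.+1 g y| < 2^-1.
    have /cvg_norm/cvgr_lt := continuous_iter _ _ m.+1 gc x.
    exact.
  exists ([set y | `|iter m.+1 g y| < 2^-1], [set N | (m.+1 <= N)%N]) => /=.
    by split=> //; exists m.+1.
  by move=> [y N] /= [yh mN]; exists m.+1.
move=> [N _ KP]; exists N => x.
have [->|x0] := eqVneq x 0.
  have [j jN _] : P N 0 by apply: (KP N) => //=; rewrite /K /= normr0.
  by exists j; rewrite // homogeneous0 ?normr0 ?mul0r //; exact: homogeneous_iter.
have nx : 0 < `|x| by rewrite normr_gt0.
have [|j jN] := KP N (leqnn N) (`|x|^-1 *: x); first by rewrite /K /= normfZV.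
rewrite (homogeneous_iter _ _ _ j gh) ?invr_ge0 // normrZ gtr0_norm ?invr_gt0 //.
by rewrite ltr_pdivrMl // => /ltW; exists j.
Qed.

(** A pure recursion on orbits: each block of N steps contains a halving, and M
    controls what happens inside the last, incomplete block. *)
Lemma halving_decay (R : realType) (V : normedModType R) (g : V -> V)
    (N : nat) (M : R) :
  0 <= M ->
  (forall n x, (n <= N)%N -> `|iter n g x| <= M * `|x|) ->
  (forall x, exists2 j : nat, (0 < j <= N)%N & `|iter j g x| <= `|x| / 2) ->
  forall k n x, (k * N <= n)%N -> `|iter n g x| <= M / 2 ^+ k * `|x|.
Proof.
move=> M0 bM halve.
have split_orbit j n x : (j <= n)%N -> iter n g x = iter (n - j) g (iter j g x).
  by move=> jn; rewrite -iterD subnK.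
elim=> [|k IHk] n x; last first.
  rewrite mulSn => kn; have [j /andP[j0 jN] jx] := halve x.
  rewrite (split_orbit j); last by rewrite (leq_trans jN) // (leq_trans _ kn) ?leq_addr.
  have kj : (k * N <= n - j)%N.
    by rewrite leq_subRL ?(leq_trans _ kn) ?leq_add2r // (leq_trans jN) ?leq_addr.
  apply: le_trans (IHk _ _ kj) _.
  rewrite exprSr invfM mulrA -[leRHS]mulrA [2^-1 * _]mulrC.
  by rewrite ler_wpM2l // divr_ge0 // exprn_ge0.
move=> _; rewrite expr0 divr1.
elim/ltn_ind: n x => n IHn x.
have [/bM->//|Nn] := leqP n N.
have [j /andP[j0 jN] jx] := halve x.
have jn : (j <= n)%N := leq_trans jN (ltnW Nn).
rewrite (split_orbit j) //; apply: le_trans (IHn (n - j)%N _ _) _.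
  by rewrite ltn_subrL j0 (leq_trans j0).
rewrite ler_wpM2l // (le_trans jx) // ler_pdivrMr // ler_peMr //.
by rewrite ler1n.
Qed.

(** The two halves of asymptotic stability in quantitative form, uniform over
    the whole space because they are relative to the norm of x. *)
Lemma homogeneous_iter_decay (R : realType) (d : nat)
    (g : 'rV[R]_d -> 'rV[R]_d) :
  continuous g -> linearly_homogeneous g ->
  (forall x, iter n g x @[n --> \oo] --> (0 : 'rV[R]_d)) ->
  (exists2 M : R, 0 <= M & forall n x, `|iter n g x| <= M * `|x|) /\
  (forall e : R, 0 < e ->
    \forall n \near \oo, forall x, `|iter n g x| <= e * `|x|).
Proof.
move=> gc gh gcv; have [N halve] := uniform_halving_time _ _ _ gc gh gcv.
have [M M0 bM] := homogeneous_iter_bounded _ _ _ N gc gh.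
have decay := halving_decay _ _ _ _ _ M0 bM halve.
split=> [|e e0].
  by exists M => // n x; have := decay 0%N n x (leq0n _); rewrite expr0 divr1.
have cvM : M * 2^-1 ^+ k @[k --> \oo] --> M * 0.
  apply: cvgMl_tmp; apply: cvg_expr.
  by rewrite gtr0_norm ?invr_gt0 // invf_lt1 // ltr1n.
rewrite mulr0 in cvM.
have [k _ /(_ k (leqnn k)) /= Mk] := cvgr_lt _ cvM _ e0.
exists (k * N)%N => // n /= kn x.
by apply: le_trans (decay k n x kn) _; rewrite ler_wpM2r // ltW // -exprVn.
Qed.

Lemma homogeneous_local_to_global (R : realType) (d : nat)
    (g : 'rV[R]_d -> 'rV[R]_d) (r : R) :
  linearly_homogeneous g -> 0 < r ->
  (forall x, eball d r x -> iter n g x @[n --> \oo] --> (0 : 'rV[R]_d)) ->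
  forall x, iter n g x @[n --> \oo] --> (0 : 'rV[R]_d).
Proof.
move=> gh r0 gcv x.
pose c := Num.sqrt d%:R * `|x|.
have c1 : 0 < c + 1 by rewrite ltr_wpDl // mulr_ge0 ?sqrtr_ge0.
pose a := r / (c + 1).
have a0 : 0 < a by rewrite divr_gt0.
have /gcv cv : eball d r (a *: x).
  apply: le_lt_trans (enorm_le_norm _ _ _) _.
  rewrite normrZ gtr0_norm // mulrCA -/c /a mulrAC ltr_pdivrMr //.
  by rewrite ltr_pM2l // ltrDl.
suff -> : (fun n => iter n g x) = (fun n => a^-1 *: iter n g (a *: x)).
  by rewrite -[X in _ --> X](scaler0 _ a^-1); exact: cvgZl_tmp cv.
apply/funext => n.
by rewrite homogeneous_iter ?ltW // scalerA mulVf ?gt_eqF // scale1r.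
Qed.

Theorem lemma3p1 (R : realType) (d : nat) (hd : (1 <= d)%N)
    (g : 'rV[R]_d -> 'rV[R]_d)
    (g_cont : continuous g) (g_hom : linearly_homogeneous g)
    (r : R) (r_gt0 : 0 < r)
    (g_cvg : forall x : 'rV[R]_d, eball d r x ->
       iter n g x @[n --> \oo] --> (0 : 'rV[R]_d)) :
  globally_asymptotically_stable g /\
  {uniform eball d r, (fun n : nat => iter n g) @ \oo --> (cst (0 : 'rV[R]_d))}.
Proof.
have cvg0 := homogeneous_local_to_global _ _ _ _ g_hom r_gt0 g_cvg.
have [[M M0 bM] decay] := homogeneous_iter_decay _ _ _ g_cont g_hom cvg0.
split.
  split=> //; first exact: homogeneous0.
  move=> eps eps0; pose c := Num.sqrt d%:R * M.
  have c0 : 0 <= c by rewrite mulr_ge0 ?sqrtr_ge0.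
  (* c alone would be the natural ratio, but it vanishes when M = 0 *)
  have c1 : 0 < c + 1 by rewrite ltr_wpDl.
  exists (eps / (c + 1)) => [|x]; first by rewrite divr_gt0.
  rewrite /eball /= ltr_pdivlMr // => xd n.
  apply: le_lt_trans (enorm_le_norm _ _ _) (le_lt_trans _ xd).
  apply: (@le_trans _ _ (c * `|x|)).
    by rewrite /c -mulrA ler_wpM2l ?sqrtr_ge0.
  rewrite mulrC ler_pM ?norm_le_enorm //.
  by rewrite lerDl.
move=> P /uniform_nbhs[E [entE EP]].
move: entE; rewrite -entourage_ballE => -[e /= e0 eE].
have er0 : 0 < e / r by rewrite divr_gt0.
have := decay _ er0; apply: filterS => n gn; apply: EP => x xr; apply: eE => /=.
rewrite -ball_normE /= sub0r normrN; apply: le_lt_trans (gn x) _.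
by rewrite mulrAC ltr_pdivrMr // ltr_pM2l // (le_lt_trans (norm_le_enorm _ _ _)).
Qed.
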